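(* Let $p$ be a prime and let $(\Omega,S)$ be an association scheme such that $\mathbf{O}_\theta(S)\subsetneq \mathbf{O}^\theta(S)$, $n_s\in\{1,p\}$ for each $s\in S$, and $n_{\mathbf{O}^\theta(S)}=p^2$. Then $|\Omega|\le p^2(p+1)$.
   Context: A coherent configuration is a pair $(\Omega,S)$ of a finite set $\Omega$ and a partition $S$ of $\Omega\times\Omega$ such that the diagonal $1_\Omega$ is a union of elements of $S$, $s^\ast:=\{(\beta,\alpha)\mid(\alpha,\beta)\in s\}\in S$ for each $s\in S$, and for all $s,t\in S$ the adjacency matrices satisfy $\sigma_s\sigma_t=\sum_{u\in S}c_{st}^u\sigma_u$ with nonnegative integers $c_{st}^u$. It is an association scheme if $1_\Omega\in S$. For $s\in S$ put $n_s:=c_{ss^\ast}^{1_\Omega}$ (for $\alpha\in\Omega$, $n_s=|\{\beta\mid(\alpha,\beta)\in s\}|$), and for $T\subseteq S$ put $n_T:=\sum_{t\in T}n_t$. For $T,U\subseteq S$ the complex product is $TU:=\{s\in S\mid c_{tu}^s>0$ for some $t\in T,u\in U\}$, and $T^\ast:=\{t^\ast\mid t\in T\}$. A nonempty $T\subseteq S$ is closed if $TT^\ast\subseteq T$; then $\bigcup_{t\in T}t$ is an equivalence relation with classes $\alpha T$, and the factor scheme $(\Omega/T,S/\!\!/T)$ has point set $\Omega/T=\{\alpha T\mid\alpha\in\Omega\}$ and relations $s^T:=\{(\alpha T,\beta T)\mid$ some $(\gamma,\delta)\in s$ with $\gamma\in\alpha T,\delta\in\beta T\}$, $s\in S$.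 A scheme is thin if all its relations have valency $1$. The thin radical is $\mathbf{O}_\theta(S):=\{s\in S\mid n_s=1\}$, and the thin residue $\mathbf{O}^\theta(S)$ is the smallest closed subset $T$ of $S$ such that $S/\!\!/T$ is thin. *)

(* Defs.v *)
From mathcomp Require Import all_boot all_order all_algebra.

Set Implicit Arguments.
Unset Strict Implicit.
Unset Printing Implicit Defensive.

Section Configurations.

Variable Omega : finType.
Implicit Types (s t u : {set Omega * Omega}) (S T U : {set {set Omega * Omega}}).

Definition diag : {set Omega * Omega} := [set e | e.1 == e.2].

Definition conv s : {set Omega * Omega} := [set e | (e.2, e.1) \in s].

Definition adj s : 'M[nat]_#|Omega| :=
  \matrix_(i, j) nat_of_bool ((enum_val i, enum_val j) \in s).

(* The coefficient c_{st}^u: in an expansion of [adj s *m adj t] over the      *)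
(* adjacency matrices of a partition it is the entry of the product at any     *)
(* pair in u, whatever the pair picked (see [intnumE]).                        *)
Definition intnum s t u : nat :=
  if [pick e in u] is Some e
  then (adj s *m adj t)%R (enum_rank e.1) (enum_rank e.2) else 0.

Definition coherent_configuration S : Prop :=
  [/\ partition S [set: Omega * Omega],
      exists2 D : {set {set Omega * Omega}}, D \subset S & diag = cover D,
      forall s, s \in S -> conv s \in S
    & forall s t, s \in S -> t \in S ->
        (adj s *m adj t = \sum_(u in S) intnum s t u *: adj u)%R].

Definition association_scheme S : Prop :=
  coherent_configuration S /\ diag \in S.

Definition valency s : nat := intnum s (conv s) diag.

Definition valency_set T : nat := \sum_(t in T) valency t.

Definition complex_product S T U : {set {set Omega * Omega}} :=
  [set s in S | [exists t in T, exists u in U, 0 < intnum t u s]].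

Definition closed_subset S T : bool :=
  [&& T != set0, T \subset S & complex_product S T (conv @: T) \subset T].

Definition thin S : bool := [forall s in S, valency s == 1].

Definition thin_radical S : {set {set Omega * Omega}} :=
  [set s in S | valency s == 1].

Definition coset T (a : Omega) : {set Omega} := [set b | (a, b) \in cover T].

Definition cosets T : {set {set Omega}} := [set coset T a | a : Omega].

Definition factor_point T : finType := {A : {set Omega} | A \in cosets T}.

Definition factor_rel T s : {set factor_point T * factor_point T} :=
  [set e : factor_point T * factor_point T |
     [exists d in s, (d.1 \in val e.1) && (d.2 \in val e.2)]].

Definition factor_scheme S T : {set {set factor_point T * factor_point T}} :=
  [set factor_rel T s | s in S].

End Configurations.

(* The intersection of all closed T with thin S//T; [thin_residueP] shows that *)
(* it is the smallest such T.                                                  *)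
Definition thin_residue (Omega : finType) (S : {set {set Omega * Omega}}) :
    {set {set Omega * Omega}} :=
  \bigcap_(T : {set {set Omega * Omega}} |
             closed_subset S T && thin (factor_scheme S T)) T.

Lemma adj_mulE (Omega : finType) (s t : {set Omega * Omega}) a b :
  (adj s *m adj t)%R (enum_rank a) (enum_rank b)
  = #|[set c | ((a, c) \in s) && ((c, b) \in t)]|.
Proof.
rewrite mxE (reindex (@enum_rank Omega)) /=; last first.
  by apply: onW_bij; exact: enum_rank_bij.
rewrite cardsE -[RHS]sum1_card [RHS]big_mkcond /=; apply: eq_bigr => c _.
by rewrite !mxE !enum_rankK unfold_in /=; case: (_ \in s); case: (_ \in t).
Qed.

Lemma mem_conv (Omega : finType) (s : {set Omega * Omega}) a b : ((a, b) \in conv s) = ((b, a) \in s).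
Proof. by rewrite inE. Qed.

Section ThinResidue.

Variable Omega : finType.
Implicit Types (s t u : {set Omega * Omega}) (S T U : {set {set Omega * Omega}}).

Variable S : {set {set Omega * Omega}}.
Hypothesis schS : association_scheme S.

Let trivS : trivIset S.
Proof. by case: schS => -[/and3P[]]. Qed.

Let diagS : diag Omega \in S. Proof. by case: schS. Qed.

Let convS s : s \in S -> conv s \in S.
Proof. by case: schS => -[_ _ + _] _; apply. Qed.

Lemma rel_of a b : exists2 s, s \in S & (a, b) \in s.
Proof.
have: (a, b) \in cover S by case: schS => -[/and3P[/eqP-> _ _]]; rewrite inE.
by case/bigcupP=> s; exists s.
Qed.

Lemma rel_uniq s t e : s \in S -> t \in S -> e \in s -> e \in t -> s = t.
Proof.
move=> sS tS es et; apply/eqP/negPn/negP => nst.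
by have /pred0P/(_ e) := trivIsetP trivS s t sS tS nst; rewrite /= es et.
Qed.

Lemma rel_nonempty s : s \in S -> exists e, e \in s.
Proof.
move=> sS; apply/set0Pn; case: schS => -[/and3P[_ _ n0]] _ _ _ _.
by apply: contraNneq n0 => <-.
Qed.

Lemma intnumE s t u a b : s \in S -> t \in S -> u \in S -> (a, b) \in u ->
  intnum s t u = #|[set c | ((a, c) \in s) && ((c, b) \in t)]|.
Proof.
move=> sS tS uS abu; rewrite -adj_mulE.
case: schS => -[_ _ _ /(_ s t sS tS) ->] _.
rewrite summxE (bigD1 u) //= big1 => [|v /andP[vS vu]].
  by rewrite !mxE !enum_rankK abu GRing.addr0; exact: esym (GRing.mulr1 _).
rewrite !mxE !enum_rankK; case: (boolP (_ \in v)) => [abv|_]; last exact: GRing.mulr0.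
by case/eqP: vu; exact: rel_uniq abv abu.
Qed.

Lemma valencyE s a : s \in S -> valency s = #|[set b | (a, b) \in s]|.
Proof.
move=> sS; rewrite /valency (@intnumE _ _ _ a a) ?convS //; last by rewrite inE.
by apply: eq_card => b; rewrite !inE /= andbb.
Qed.

Lemma transfer s t u a b c a' b' : s \in S -> t \in S -> u \in S ->
  (a, b) \in u -> (a, c) \in s -> (c, b) \in t -> (a', b') \in u ->
  exists2 c', (a', c') \in s & (c', b') \in t.
Proof.
move=> sS tS uS abu acs cbt abu'.
have : 0 < #|[set c | ((a', c) \in s) && ((c, b') \in t)]|.
  rewrite -(intnumE sS tS uS abu') (intnumE sS tS uS abu).
  by apply/card_gt0P; exists c; rewrite inE acs.
by case/card_gt0P => c'; rewrite inE => /andP[]; exists c'.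
Qed.

Lemma transfer1 s a b a' : s \in S -> (a, b) \in s -> exists b', (a', b') \in s.
Proof.
move=> sS abs; have aa c : (c, c) \in diag Omega by rewrite inE.
have bas : (b, a) \in conv s by rewrite mem_conv.
by have [b' ? _] := transfer sS (convS sS) diagS (aa a) abs bas (aa a'); exists b'.
Qed.

Lemma complex_productP T U s :
  reflect (s \in S /\ exists t u, [/\ t \in T, u \in U & 0 < intnum t u s])
          (s \in complex_product S T U).
Proof.
rewrite inE; apply: (iffP andP) => -[sS].
  by case/exists_inP=> t tT /exists_inP[u uU c0]; split=> //; exists t, u.
case=> t [u [tT uU c0]]; split=> //.
by apply/exists_inP; exists t => //; apply/exists_inP; exists u.
Qed.

Section Closed.

Variable T : {set {set Omega * Omega}}.
Hypothesis clT : closed_subset S T.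

Let sTS : T \subset S. Proof. by case/and3P: clT. Qed.

Lemma mem_cover_closed u a b : u \in S -> (a, b) \in u ->
  ((a, b) \in cover T) = (u \in T).
Proof.
move=> uS abu; apply/bigcupP/idP => [[t tT abt]|uT]; last by exists u.
by rewrite -(rel_uniq (subsetP sTS _ tT) uS abt abu).
Qed.

Lemma closed_quot a b c :
  (a, c) \in cover T -> (b, c) \in cover T -> (a, b) \in cover T.
Proof.
move=> /bigcupP[s sT acs] /bigcupP[t tT bct].
have [u uS abu] := rel_of a b; rewrite (mem_cover_closed uS abu).
case/and3P: clT => _ _ /subsetP; apply; apply/complex_productP; split=> //.
exists s, (conv t); rewrite imset_f //; split=> //.
rewrite (intnumE _ _ uS abu) ?convS ?(subsetP sTS) //.
by apply/card_gt0P; exists c; rewrite !inE acs.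
Qed.

Lemma closed_refl a : (a, a) \in cover T.
Proof.
case/and3P: clT => /set0Pn[t tT] _ _.
have tS := subsetP sTS _ tT.
have [[x y] xyt] := rel_nonempty tS; have [b abt] := transfer1 a tS xyt.
by apply: (@closed_quot a a b); apply/bigcupP; exists t.
Qed.

Lemma closed_sym a b : (a, b) \in cover T -> (b, a) \in cover T.
Proof. by move=> ab; apply: closed_quot (closed_refl b) ab. Qed.

Lemma closed_trans a b c :
  (a, b) \in cover T -> (b, c) \in cover T -> (a, c) \in cover T.
Proof. by move=> ab /closed_sym; exact: closed_quot. Qed.

Lemma coset_eq a b : (coset T a == coset T b) = ((a, b) \in cover T).
Proof.
apply/eqP/idP => [/setP/(_ b)|ab]; first by rewrite !inE closed_refl.
apply/setP=> c; rewrite !inE; apply/idP/idP; last exact: closed_trans.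
by apply: closed_trans; exact: closed_sym.
Qed.

Lemma coset_in a : coset T a \in cosets T. Proof. exact: imset_f. Qed.

Definition to_point a : factor_point T := exist _ (coset T a) (coset_in a).

Lemma pointP (X : factor_point T) : exists a, X = to_point a.
Proof.
case: X => A AT; have /imsetP[a _ E] := AT; exists a.
by apply: val_inj.
Qed.

Lemma to_point_eq a b : (to_point a == to_point b) = ((a, b) \in cover T).
Proof. by rewrite -coset_eq. Qed.

Lemma mem_point a b : (b \in val (to_point a)) = ((a, b) \in cover T).
Proof. by rewrite inE. Qed.

Lemma mem_factor_rel s a b : reflect
  (exists a' b', [/\ (a, a') \in cover T, (b, b') \in cover T & (a', b') \in s])
  ((to_point a, to_point b) \in factor_rel T s).
Proof.
rewrite inE; apply: (iffP exists_inP) => [[[a' b'] ? /andP[]]|[a' [b' [? ? ?]]]].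
  by rewrite !mem_point; exists a', b'.
by exists (a', b') => //; rewrite !mem_point; apply/andP.
Qed.

End Closed.

Definition strongly_normal T := forall s a b a' b', s \in S ->
  (a, b) \in s -> (a', b') \in s -> (a, a') \in cover T -> (b, b') \in cover T.

Lemma thin_factorP T : closed_subset S T ->
  reflect (strongly_normal T) (thin (factor_scheme S T)).
Proof.
move=> clT.
have vE r : exists x, valency (r : {set factor_point T * factor_point T})
    = #|[set Y | (to_point T x, Y) \in r]|.
  rewrite /valency /intnum; case: pickP => [[X Y]|d0].
    rewrite inE /= => /eqP <-; have [x ->] := pointP X; exists x.
    rewrite /= adj_mulE; apply: eq_card => Z.
    by rewrite [in LHS]inE mem_conv andbb inE.
  have [[x0 _] _] := rel_nonempty diagS.
  by have := d0 (to_point T x0, to_point T x0); rewrite /= inE eqxx.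
apply: (iffP forall_inP) => [thT s a b a' b' sS abs abs' /bigcupP[t tT aat] | snT r].
  have tS : t \in S by case/and3P: clT => _ /subsetP->.
  have [v vS abv] := rel_of a b'; have [u uS bbu] := rel_of b b'.
  have /thT : factor_rel T s \in factor_scheme S T by exact: imset_f.
  have [x ->] := vE (factor_rel T s) => /cards1P[Y defY].
  have [y xys] := transfer1 x sS abs.
  have bbu' : (b', b) \in conv u by rewrite mem_conv.
  have [z xzv] := transfer vS (convS uS) sS abs abv bbu' xys.
  rewrite mem_conv => yzu.
  have [x' xxt xzs] := transfer tS sS vS abv aat abs' xzv.
  rewrite (mem_cover_closed clT uS bbu) -(mem_cover_closed clT uS yzu).
  rewrite -(to_point_eq clT).
  have inY w : (to_point T x, to_point T w) \in factor_rel T s -> to_point T w = Y.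
    by move=> xw; apply/set1P; rewrite -defY inE.
  apply/eqP; transitivity Y; [|apply: esym]; apply: inY; apply/mem_factor_rel.
    by exists x, y; split=> //; exact: closed_refl.
  by exists x', z; split=> //; [apply/bigcupP; exists t | exact: closed_refl].
case/imsetP=> s sS ->; have [x ->] := vE (factor_rel T s).
have [[a b] abs] := rel_nonempty sS; have [y xys] := transfer1 x sS abs.
apply/cards1P; exists (to_point T y); apply/setP=> Z; have [z ->] := pointP Z.
rewrite !inE (to_point_eq clT); apply/idP/idP => [xz|zy].
  have /mem_factor_rel[x' [z' [xx zz xzs]]] : (to_point T x, to_point T z) \in factor_rel T s.
    by rewrite inE.
  apply: (closed_trans clT zz); apply: closed_sym => //.
  exact: snT sS xys xzs xx.
have : (to_point T x, to_point T z) \in factor_rel T s; last by rewrite inE.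
by apply/mem_factor_rel; exists x, y; split=> //; exact: closed_refl.
Qed.

Lemma thin_residueP :
  [/\ closed_subset S (thin_residue S),
      thin (factor_scheme S (thin_residue S))
    & forall T, closed_subset S T -> thin (factor_scheme S T) ->
        thin_residue S \subset T].
Proof.
have clS : closed_subset S S.
  rewrite /closed_subset subxx; apply/and3P; split=> //.
    by apply/set0Pn; exists (diag Omega).
  by apply/subsetP=> s; rewrite inE => /andP[].
have covS a b : (a, b) \in cover S.
  by have [s sS abs] := rel_of a b; apply/bigcupP; exists s.
have thS : thin (factor_scheme S S).
  by apply/(thin_factorP clS) => s a b a' b' *; exact: covS.
have leT T : closed_subset S T -> thin (factor_scheme S T) -> thin_residue S \subset T.
  by move=> cT tT; apply: bigcap_inf; rewrite cT.
have inR u : u \in S -> (forall T, closed_subset S T ->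
    thin (factor_scheme S T) -> u \in T) -> u \in thin_residue S.
  by move=> uS uT; apply/bigcapP=> T /andP[]; apply: uT.
have clR : closed_subset S (thin_residue S).
  apply/and3P; split; last 1 first.
  - apply/subsetP=> s /complex_productP[sS [t [u [tR /imsetP[v vR ->] c0]]]].
    apply: inR => // T clT thT; have RT := subsetP (leT T clT thT).
    case/and3P: clT => _ _ /subsetP; apply; apply/complex_productP; split=> //.
    by exists t, (conv v); rewrite imset_f ?RT.
  - apply/set0Pn; exists (diag Omega); apply: inR => // T clT _.
    have [[x y] xy] := rel_nonempty diagS.
    rewrite -(mem_cover_closed clT diagS xy).
    by move: xy; rewrite inE => /eqP /= ->; exact: closed_refl.
  - exact: leT.
split=> //; apply/(thin_factorP clR) => s a b a' b' sS abs abs' /bigcupP[t tR aat].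
have [u uS bbu] := rel_of b b'; rewrite (mem_cover_closed clR uS bbu).
apply: inR => // T clT thT; rewrite -(mem_cover_closed clT uS bbu).
apply: (thin_factorP clT thT) sS abs abs' _; apply/bigcupP; exists t => //.
exact: (subsetP (leT T clT thT)).
Qed.

End ThinResidue.

(* Main.v *)
(** Write [T] for the thin residue and [C] for the thin radical.  Counting shows
    that [C] has order [p] and that, inside a coset of [T], two points in
    different cosets of [C] are related by a relation that is a union of products
    of cosets of [C].  Outside [T], [C] permutes the [p] relations joining two
    cosets of [T] either trivially or regularly, and the relations for which it is
    trivial induce a subgroup [K/T] of [S//T].  If [K = S] then [C] would be
    strongly normal; if [T < K < S] one gets two affine planes on one coset of [T],
    sharing the parallel class of cosets of [C], such that every other line of the
    first meets every other line of the second exactly once, which is absurd.  So [K = T].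

    Fix a coset [B] of [T] and a nontrivial character [chi] of [C].  Functions on
    [B] that transform under [chi] form a space of dimension [p]; the cosets of
    [C] in [B] give one orthogonal basis, every other coset of [T] gives another
    one, and these bases are mutually unbiased.  There are at most [p + 1]
    mutually unbiased bases in dimension [p], whence [|S//T| <= p + 1].  Here the
    last bound is proved by a second-moment count over all [chi] at once: if
    [b0, b1] in [B] lie in different cosets of [C], then [hits] is, up to
    centering, the sum over the unbiased bases of the projections of the matrix
    unit at [(b0, b1)] onto their diagonal operators, and Bessel's inequality for
    these orthogonal projections is the claim. *)

Require Import Defs.
From mathcomp Require Import all_boot all_fingroup all_solvable zify.

Set Implicit Arguments.
Unset Strict Implicit.
Unset Printing Implicit Defensive.

(** * Finite counting and the final arithmetic *)

Lemma card_uniform_equivalence (X : finType) (R : rel X) (D : {set X}) n :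
  equivalence_rel R -> (forall x, x \in D -> #|[set y in D | R x y]| = n) ->
  n %| #|D|.
Proof.
move=> eqR cardR.
have eqRD : {in D & &, equivalence_rel R} by move=> x y z _ _ _; exact: eqR.
rewrite (card_uniform_partition (n := n) _ (equivalence_partitionP eqRD)) ?dvdn_mull //.
by move=> A /imsetP[x xD ->]; exact: cardR.
Qed.

Lemma sum_nat_eq_leq1 (X : finType) (P Q : pred X) :
  (forall x y, P x -> P y -> Q x -> Q y -> x = y) ->
  \sum_(x | P x) nat_of_bool (Q x) <= 1.
Proof.
move=> inj; rewrite -big_mkcondr sum1_card /=.
apply/card_le1_eqP => x y; rewrite !unfold_in => /andP[Px Qx] /andP[Py Qy].
exact: inj.
Qed.

Lemma exchange_sum_prod (I J K : finType) (P : pred I) (Q : pred J) (R : pred K)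
    (f : K -> I -> nat) (g : K -> J -> nat) :
  \sum_(i | P i) \sum_(j | Q j) \sum_(k | R k) f k i * g k j
  = \sum_(k | R k) (\sum_(i | P i) f k i) * (\sum_(j | Q j) g k j).
Proof.
transitivity (\sum_(k | R k) \sum_(i | P i) \sum_(j | Q j) f k i * g k j).
  by rewrite [RHS]exchange_big /=; apply: eq_bigr => i _; exact: exchange_big.
by apply: eq_bigr => k _; rewrite big_distrlr.
Qed.

(** Here [m] counts the points outside a coset of T; [Qd], [Qr], [F] are moments of [hits]; [A] and
    [R] count pairs. Eliminating all but [p] and [m] leaves [m ^ 2 * p ^ 2 * (p - 1) <= m * p ^ 5 *
    (p - 1)]. *)
Lemma moment_bound p m Qd Qr F R A : 1 < p -> 0 < m ->
  Qd + Qr <= m * (p * p ^ 3 + (p ^ 2 - p) * p ^ 2) + A * p ^ 2 ->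
  m * p + F = m * p ^ 3 -> p ^ 4 = p ^ 2 + R -> p * m ^ 2 <= Qd ->
  2 * (p * m) * F <= p ^ 2 * Qr + m ^ 2 * R -> A + m * p ^ 2 = m * m ->
  m <= p ^ 3.
Proof.
case: p => [//|q] q_gt0 m_gt0.
rewrite (_ : q.+1 ^ 2 - q.+1 = q * q.+1); last first.
  by rewrite -mulnn -[X in _ - X]mul1n -mulnBl subn1.
have [p pE] : exists p, p = q.+1 by exists q.+1.
rewrite -pE => Qle total size diag_le amgm apartE.
(* Each hypothesis is scaled so that the goal becomes a linear combination of them over
   monomials. *)
have {}Qle : p ^ 2 * (Qd + Qr) <= p ^ 2 * (m * (p * p ^ 3 + q * p * p ^ 2) + A * p ^ 2).
  by rewrite leq_mul2l Qle orbT.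
have {}total := congr1 (muln (p * m)) total.
have {}size := congr1 (muln (m ^ 2)) size.
have {}diag_le : p ^ 2 * (p * m ^ 2) <= p ^ 2 * Qd by rewrite leq_mul2l diag_le orbT.
have {}apartE := congr1 (muln (p ^ 4)) apartE.
have : m * (p ^ 2 * q) * m <= m * (p ^ 2 * q) * p ^ 3.
  by subst p; lia.
by rewrite leq_pmul2l // !muln_gt0 m_gt0 pE.
Qed.

(** * Relations as colours of pairs of points *)

Section Relations.

Variables (Omega : finType) (S : {set {set Omega * Omega}}).
Hypothesis hS : association_scheme S.

Definition rho (a b : Omega) : {set Omega * Omega} := pblock S (a, b).

Lemma cover_scheme a b : (a, b) \in cover S.
Proof. by case: hS => -[/and3P[/eqP-> _ _] _ _ _] _; rewrite inE. Qed.

Lemma rho_in a b : rho a b \in S.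
Proof. exact/pblock_mem/cover_scheme. Qed.

Lemma mem_rho a b : (a, b) \in rho a b.
Proof. by rewrite mem_pblock cover_scheme. Qed.

Lemma rho_eq s a b : s \in S -> (rho a b == s) = ((a, b) \in s).
Proof.
move=> sS; apply/eqP/idP => [<-|abs]; first exact: mem_rho.
by apply: (rel_uniq hS (rho_in a b) sS (mem_rho a b)).
Qed.

Lemma conv_in s : s \in S -> conv s \in S.
Proof. by case: hS => -[_ _ + _] _; apply. Qed.

Lemma conv_rho a b : conv (rho a b) = rho b a.
Proof. by apply/eqP; rewrite eq_sym rho_eq ?conv_in ?rho_in // inE mem_rho. Qed.

Lemma rho_sym a b c d : rho a b = rho c d -> rho b a = rho d c.
Proof. by rewrite -(conv_rho a b) -(conv_rho c d) => ->. Qed.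

Lemma rho_diag a : rho a a = diag Omega.
Proof. by apply/eqP; rewrite rho_eq ?inE //; case: hS. Qed.

(** The count depends on [a] and [b] only through [rho a b]. *)
Lemma card_meet a b s t : s \in S -> t \in S ->
  #|[set x | (rho a x == s) && (rho b x == t)]| = intnum s (conv t) (rho a b).
Proof.
move=> sS tS; rewrite (intnumE hS sS (conv_in tS) (rho_in a b) (mem_rho a b)).
by apply: eq_card => x; rewrite !inE /= !rho_eq.
Qed.

Lemma rho_transfer a b a' b' x : rho a b = rho a' b' ->
  exists2 x', rho a' x' = rho a x & rho b' x' = rho b x.
Proof.
move=> e; have : 0 < #|[set y | (rho a' y == rho a x) && (rho b' y == rho b x)]|.
  rewrite card_meet ?rho_in // -e -card_meet ?rho_in //.
  by apply/card_gt0P; exists x; rewrite inE !eqxx.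
by case/card_gt0P=> y; rewrite inE => /andP[/eqP ? /eqP ?]; exists y.
Qed.

Lemma rho_exists a b a' : exists b', rho a' b' = rho a b.
Proof.
have e : rho a a = rho a' a' by rewrite !rho_diag.
by have [b' ? _] := rho_transfer b e; exists b'.
Qed.

Lemma card_rho a s : s \in S -> #|[set x | rho a x == s]| = valency s.
Proof.
by move=> sS; rewrite (valencyE hS a sS); apply: eq_card => x; rewrite !inE rho_eq.
Qed.

Lemma card_rho_mem a (U : {set {set Omega * Omega}}) : U \subset S ->
  #|[set x | rho a x \in U]| = valency_set U.
Proof.
move=> /subsetP US; rewrite -sum1_card (partition_big (rho a) [in U]) /=.
  apply: eq_bigr => s sU; rewrite -(card_rho a (US _ sU)) -sum1_card.
  apply: eq_bigl => x; rewrite !inE; case: eqP => [->|_]; last by rewrite andbF.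
  by rewrite sU.
by move=> x; rewrite inE.
Qed.

(** [s] and [conv s] have equally many pairs, namely [#|Omega|] times their valencies. *)
Lemma valency_conv s : s \in S -> valency (conv s) = valency s.
Proof.
move=> sS; have [[a0 _] _] := rel_nonempty hS sS.
have Om0 : 0 < #|Omega| by apply/card_gt0P; exists a0.
suff E t : t \in S -> #|t| = #|Omega| * valency t.
  apply/eqP; rewrite -(eqn_pmul2l Om0) -!E ?conv_in //; apply/eqP.
  have swI : injective (fun e : Omega * Omega => (e.2, e.1)) by move=> [? ?] [? ?] [-> ->].
  by rewrite -(card_preimset s swI); apply: eq_card => e; rewrite !inE.
move=> tS; rewrite -sum1_card (partition_big (fun e => e.1) predT) //=.
rewrite -sum_nat_const; apply: eq_bigr => a _.
have pairI : injective (pair a : Omega -> _) by move=> ? ? [].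
rewrite -(card_rho a tS) sum1dep_card -(card_imset _ pairI).
apply: eq_card => -[b c]; rewrite !inE /=; apply/idP/imsetP.
  by case/andP=> bct /eqP<-; exists c; rewrite // inE rho_eq.
by case=> d; rewrite inE rho_eq // => ? [-> ->]; rewrite eqxx andbT.
Qed.

End Relations.

(** * The thin radical as a group of permutations *)

Section Thin.

Variables (Omega : finType) (S : {set {set Omega * Omega}}).
Hypothesis hS : association_scheme S.

Local Notation rho := (rho S).

Definition thinR (a b : Omega) : bool := rho a b \in thin_radical S.

Lemma thinRE a b : thinR a b = (valency (rho a b) == 1).
Proof. by rewrite /thinR inE rho_in. Qed.

Lemma thinR_eq a b c d : rho a b = rho c d -> thinR a b = thinR c d.
Proof. by rewrite /thinR => ->. Qed.

Lemma thinR_sym a b : thinR a b = thinR b a.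
Proof. by rewrite !thinRE -(conv_rho hS a b) (valency_conv hS) ?rho_in. Qed.

Lemma thinR_uniq a b c : thinR a b -> rho a c = rho a b -> c = b.
Proof.
rewrite thinRE -(card_rho hS a (rho_in hS a b)) => /cards1P[d D] e.
have /set1P-> : c \in [set d] by rewrite -D inE e.
by apply/esym/set1P; rewrite -D inE.
Qed.

Lemma thinR_refl a : thinR a a.
Proof.
rewrite thinRE -(card_rho hS a (rho_in hS a a)); apply/cards1P; exists a.
apply/setP=> b; rewrite !inE rho_diag // rho_eq //; last by case: hS.
by rewrite inE /= eq_sym.
Qed.

Lemma thinR_trans a b c : thinR a b -> thinR b c -> thinR a c.
Proof.
move=> ab bc; rewrite thinRE -(card_rho hS a (rho_in hS a c)).
apply/cards1P; exists c; apply/setP=> x; rewrite !inE.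
apply/eqP/eqP => [e|-> //].
have [b' e1 e2] := rho_transfer hS b (esym e).
have Eb := thinR_uniq ab e1; rewrite {}Eb in e1 e2.
exact: thinR_uniq bc (rho_sym hS e2).
Qed.

Lemma thinR_equiv : equivalence_rel thinR.
Proof.
move=> a b c; split=> [|ab]; first exact: thinR_refl.
apply/idP/idP; last exact: thinR_trans.
by apply: thinR_trans; rewrite thinR_sym.
Qed.

Lemma closed_thin_radical : closed_subset S (thin_radical S).
Proof.
have subS : thin_radical S \subset S by apply/subsetP=> s; rewrite inE => /andP[].
have [[a0 _] _] := rel_nonempty hS (proj2 hS).
apply/and3P; split=> //; first by apply/set0Pn; exists (rho a0 a0); exact: thinR_refl.
apply/subsetP=> s /complex_productP[sS [t [u [tC /imsetP[v vC ->]]]]].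
have [[a b]] := rel_nonempty hS sS; rewrite -(rho_eq hS) // => /eqP <-.
have [tS vS] := (subsetP subS _ tC, subsetP subS _ vC).
rewrite -card_meet // => /card_gt0P[c]; rewrite inE => /andP[/eqP act /eqP bcv].
by apply: (@thinR_trans a c b); [|rewrite thinR_sym]; rewrite /thinR ?act ?bcv.
Qed.

Lemma card_thinR_valency a : #|[set b | thinR a b]| = valency_set (thin_radical S).
Proof.
rewrite /thinR (card_rho_mem hS) //.
by apply/subsetP=> s; rewrite inE => /andP[].
Qed.

(** The graphs of these permutations are the thin relations. They need not preserve the relations of
    [S], but they permute them through either coordinate: see [thin_perm_r] and [thin_perm_l]. *)
Definition thin_perms : {set {perm Omega}} :=
  [set g : {perm Omega} | [forall x, thinR x (g x)]
     && [forall x, forall y, rho x (g x) == rho y (g y)]].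

Lemma thin_permsP (g : {perm Omega}) :
  reflect ((forall x, thinR x (g x)) /\ (forall x y, rho x (g x) = rho y (g y)))
          (g \in thin_perms).
Proof.
rewrite inE; apply: (iffP andP) => -[tg eg]; split.
- exact/forallP.
- by move=> x y; exact/eqP/(forallP (forallP eg x)).
- exact/forallP.
- by apply/forallP=> x; apply/forallP=> y; rewrite (eg x y).
Qed.

(** [g b'] is the only point in its thin relation to [b'], so transferring the triangle [a], [b],
    [g b] must end at [g b']. *)
Lemma thin_perm_r g a b a' b' : g \in thin_perms -> rho a b = rho a' b' ->
  rho a (g b) = rho a' (g b').
Proof.
case/thin_permsP=> tg eg e; have [x e1 e2] := rho_transfer hS (g b) e.
by rewrite -e1; congr (rho _ _); apply: thinR_uniq (tg b') _; rewrite e2; exact: eg.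
Qed.

Lemma thin_perm_l g a b a' b' : g \in thin_perms -> rho a b = rho a' b' ->
  rho (g a) b = rho (g a') b'.
Proof. by move=> gG /(rho_sym hS) e; exact/(rho_sym hS)/thin_perm_r. Qed.

Lemma thin_perms_group_set : group_set thin_perms.
Proof.
apply/group_setP; split.
  by apply/thin_permsP; split=> [x|x y]; rewrite !perm1 ?thinR_refl ?rho_diag.
move=> g h gG hG; have [[tg eg] [th eh]] := (thin_permsP _ gG, thin_permsP _ hG).
apply/thin_permsP; split=> [x|x y]; rewrite !permM; first exact: thinR_trans (th _).
exact/thin_perm_r.
Qed.

Definition thin_group : {group {perm Omega}} := Group thin_perms_group_set.

Lemma thin_permE a b : thinR a b -> exists2 g, g \in thin_group & g a = b.
Proof.
(* The default [x] is never taken: every point has a partner in [rho a b]. *)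
move=> ab; pose f x := odflt x [pick y | rho x y == rho a b].
have fE x : rho x (f x) = rho a b.
  rewrite /f; case: pickP => [y /eqP //|no].
  by have [y /eqP] := rho_exists hS a b x; rewrite no.
have tf x : thinR x (f x) by rewrite (thinR_eq (fE x)).
have fI : injective f.
  move=> x y exy; have e : rho (f x) y = rho (f x) x.
    by apply: (rho_sym hS); rewrite fE exy fE.
  by apply/esym; apply: thinR_uniq e; rewrite thinR_sym.
exists (perm fI); last by rewrite permE; apply: thinR_uniq ab (fE a).
by apply/thin_permsP; split=> [x|x y]; rewrite !permE ?fE.
Qed.

Lemma thin_perm_inj g h a : g \in thin_group -> h \in thin_group -> g a = h a -> g = h.
Proof.
move=> /thin_permsP[tg eg] /thin_permsP[th eh] e; apply/permP=> x.
by apply: (thinR_uniq (th x)); rewrite (eg x a) e; exact: eh.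
Qed.

Lemma card_thin_group a : #|thin_group| = #|[set b | thinR a b]|.
Proof.
rewrite -(@card_in_imset _ _ (fun g : {perm Omega} => g a) thin_group); last first.
  by move=> g h gG hG; exact: thin_perm_inj.
apply: eq_card => b; rewrite inE; apply/imsetP/idP => [[g /thin_permsP[tg _] ->] //|].
by case/thin_permE=> g gG <-; exists g.
Qed.

End Thin.

(** * Cosets of the thin residue and of the thin radical *)

Section ThinResidueOfOrderP2.

Variables (p : nat) (Omega : finType) (S : {set {set Omega * Omega}}).
Hypothesis hp : prime p.
Hypothesis hS : association_scheme S.
Hypothesis hproper : thin_radical S \proper thin_residue S.
Hypothesis hval : forall s : {set Omega * Omega}, s \in S ->
  valency s = 1 \/ valency s = p.
Hypothesis hres : valency_set (thin_residue S) = p ^ 2.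

Local Notation rho := (rho S).
Local Notation thinR := (thinR S).
Local Notation thin_group := (thin_group hS).

Definition resR (a b : Omega) : bool := rho a b \in thin_residue S.

Let p_gt0 : 0 < p. Proof. exact: prime_gt0. Qed.
Let p_gt1 : 1 < p. Proof. exact: prime_gt1. Qed.

Let clT : closed_subset S (thin_residue S).
Proof. by case: (thin_residueP hS). Qed.

Lemma resRE a b : resR a b = ((a, b) \in cover (thin_residue S)).
Proof. by rewrite (mem_cover_closed hS clT (rho_in hS a b)) ?mem_rho. Qed.

Lemma resR_eq a b c d : rho a b = rho c d -> resR a b = resR c d.
Proof. by rewrite /resR => ->. Qed.

Lemma resR_refl a : resR a a.
Proof. by rewrite resRE; exact: (closed_refl hS clT). Qed.

Lemma resR_sym a b : resR a b = resR b a.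
Proof. by rewrite !resRE; apply/idP/idP; exact: (closed_sym hS clT). Qed.

Lemma resR_trans a b c : resR a b -> resR b c -> resR a c.
Proof. by rewrite !resRE; exact: (closed_trans hS clT). Qed.

Lemma thin_resR a b : thinR a b -> resR a b.
Proof. exact: (subsetP (proper_sub hproper)). Qed.

(** Thinness of the factor scheme by T, read on points through [thin_factorP]. *)
Lemma resR_normal a b a' b' : rho a b = rho a' b' -> resR a a' -> resR b b'.
Proof.
move=> e; rewrite !resRE; case: (thin_residueP hS) => _ /(thin_factorP hS clT) + _.
by apply; [exact: (rho_in hS a b) | exact: mem_rho | rewrite e mem_rho].
Qed.

Lemma card_fiber a b : ~~ thinR a b -> #|[set x | rho a x == rho a b]| = p.
Proof.
rewrite thinRE // (card_rho hS) ?rho_in // => /negP nt.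
by case: (hval (rho_in hS a b)) => // e; case: nt; rewrite e.
Qed.

Lemma card_image_fibers a (D : {set Omega}) :
  (forall b x, b \in D -> rho a x = rho a b -> x \in D) ->
  (forall b, b \in D -> ~~ thinR a b) -> #|D| = #|rho a @: D| * p.
Proof.
move=> clD ntD; rewrite -sum1_card (partition_big_imset (rho a)) /= -sum_nat_const.
apply: eq_bigr => s /imsetP[b bD ->]; rewrite sum1dep_card -(card_fiber (ntD b bD)).
apply: eq_card => x; rewrite !inE; case: eqP => [e|_]; last by rewrite andbF.
by rewrite (clD b).
Qed.

Lemma card_resR a : #|[set b | resR a b]| = p ^ 2.
Proof. by rewrite /resR (card_rho_mem hS) //; case/and3P: clT. Qed.

(** Cosets of C split a coset of T evenly, so the order divides [p ^ 2]; the points outside the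
    coset of [a] fall into fibers of size [p], so [p] divides it; and C is proper in T. *)
Lemma card_thinR a : #|[set b | thinR a b]| = p.
Proof.
have subTC : [set b | thinR a b] \subset [set b | resR a b].
  by apply/subsetP=> b; rewrite !inE; exact: thin_resR.
have dv1 : #|[set b | thinR a b]| %| p ^ 2.
  rewrite -(card_resR a); apply: (card_uniform_equivalence (thinR_equiv hS)).
  move=> b; rewrite inE => ab.
  rewrite (card_thinR_valency hS a) -(card_thinR_valency hS b); apply: eq_card => x.
  by rewrite !inE andb_idl // => /thin_resR; exact: resR_trans.
have dv2 : p %| #|[set b | thinR a b]|.
  have := cardsID [set b | thinR a b] [set b | resR a b].
  rewrite (setIidPr subTC) card_resR => e.
  rewrite -(dvdn_addl (n := #|[set b | resR a b] :\: [set b | thinR a b]|)).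
    by rewrite e dvdn_exp.
  rewrite (@card_image_fibers a) ?dvdn_mull // => [b x|b]; rewrite !inE.
    by move=> + e1; rewrite -(thinR_eq e1) -(resR_eq e1).
  by case/andP.
have ltT : #|[set b | thinR a b]| < p ^ 2.
  rewrite -(card_resR a); apply: proper_card; rewrite properE subTC /=.
  have [_ [s sT sC]] := properP hproper.
  have sS : s \in S by case/and3P: clT => _ /subsetP->.
  have [[x y]] := rel_nonempty hS sS; rewrite -(rho_eq hS) // => /eqP es.
  have [b eb] := rho_exists hS x y a.
  apply/subsetPn; exists b; rewrite !inE /resR ?eb ?es //.
  by have -> : thinR a b = (s \in thin_radical S) by rewrite -es -eb.
case/(dvdn_pfactor _ _ hp): dv1 => -[|[|[|m]]] //= _ e; rewrite e ?expn1 // in dv2 ltT *.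
- by move: dv2 p_gt1; rewrite dvdn1 => /eqP ->.
- by rewrite ltnn in ltT.
Qed.

Lemma card_thin_group_prime : #|thin_group| = p.
Proof.
have [[a _] _] := rel_nonempty hS (proj2 hS).
by rewrite (card_thin_group hS a) card_thinR.
Qed.

Lemma thin_group_comm g h : g \in thin_group -> h \in thin_group ->
  forall x, g (h x) = h (g x).
Proof.
have /cyclic_abelian/centsP ab : cyclic thin_group.
  by apply: prime_cyclic; rewrite card_thin_group_prime.
by move=> gG hG x; rewrite -!permM (ab _ gG _ hG).
Qed.

(** * The action of the thin radical on relations *)

Definition const_on a b := forall x, thinR b x -> rho a x = rho a b.
Definition inj_on a b :=
  forall x y, thinR b x -> thinR b y -> rho a x = rho a y -> x = y.

(** The stabilizer of [rho a b] in a group of prime order is trivial or everything. *)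
Lemma const_or_inj a b : const_on a b \/ inj_on a b.
Proof.
pose St := [set g in thin_group | rho a (g b) == rho a b].
have gSt : group_set St.
  apply/group_setP; split; first by apply/setIdP; rewrite group1 perm1.
  move=> g h /setIdP[gG /eqP eg] /setIdP[hG /eqP eh]; apply/setIdP.
  by rewrite groupM // permM -eh; split=> //; apply/eqP/(thin_perm_r hS).
have sub : Group gSt \subset thin_group by apply/subsetP=> g /setIdP[].
have := cardSg sub; rewrite card_thin_group_prime => dv.
case/primeP: hp => _ /(_ _ dv) /orP[/eqP St1|/eqP Stp]; [right|left].
  move=> x y /(thin_permE hS)[g gG <-] /(thin_permE hS)[h hG <-] e.
  have : (h * g^-1)%g \in Group gSt.
    apply/setIdP; rewrite groupM ?groupV //= permM; split=> //.
    have := thin_perm_r hS (groupVr gG) (esym e).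
    by rewrite permK => ->.
  have /eqP -> : Group gSt :==: 1%g by rewrite trivg_card1 St1.
  by move/set1P/eqP; rewrite -eq_mulgV1 => /eqP->.
have E : Group gSt :=: thin_group.
  by apply/eqP; rewrite eqEcard sub card_thin_group_prime /= Stp.
move=> x /(thin_permE hS)[g gG <-].
by move: gG; rewrite -E => /setIdP[_ /eqP].
Qed.

Lemma const_on_eq a b a' b' : rho a b = rho a' b' -> const_on a b -> const_on a' b'.
Proof.
move=> e cst x /(thin_permE hS)[g gG <-].
rewrite -e -(thin_perm_r hS gG e); apply: cst.
by have [/(_ b)] := thin_permsP _ _ gG.
Qed.

(** The coset of [b] lies in the fiber, and both have [p] points. *)
Lemma const_fiber a b x : ~~ thinR a b -> const_on a b ->
  rho a x = rho a b -> thinR b x.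
Proof.
move=> nt cst e.
have sub : [set y | thinR b y] \subset [set y | rho a y == rho a b].
  by apply/subsetP=> y; rewrite !inE => /cst ->.
have /eqP/setP/(_ x) : [set y | thinR b y] == [set y | rho a y == rho a b].
  by rewrite eqEcard sub (card_fiber nt) card_thinR leqnn.
by rewrite !inE e eqxx.
Qed.

(** Injectivity would give at least [p] relations from [a] to the rest of its coset of T outside C,
    but these [p ^ 2 - p] points make up only [p - 1] fibers. *)
Lemma resR_const a b : resR a b -> ~~ thinR a b -> const_on a b.
Proof.
move=> ab nab; case: (const_or_inj a b) => // inj; exfalso.
pose D := [set x | resR a x] :\: [set x | thinR a x].
have subTC : [set x | thinR a x] \subset [set x | resR a x].
  by apply/subsetP=> x; rewrite !inE; exact: thin_resR.
have cD : #|D| = p * p - p by rewrite cardsDS // card_resR card_thinR.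
have cI : #|D| = #|rho a @: D| * p.
  apply: card_image_fibers => [y x|y]; rewrite !inE; last by case/andP.
  by move=> + e1; rewrite -(thinR_eq e1) -(resR_eq e1).
have : p <= #|rho a @: D|.
  rewrite -(card_thinR b) -(card_in_imset (f := rho a)); last first.
    by move=> x y; rewrite !inE; exact: inj.
  apply/subset_leq_card/imsetS/subsetP=> x; rewrite !inE => bx.
  rewrite (resR_trans ab (thin_resR bx)) andbT.
  apply: contra nab => ax; apply: thinR_trans ax _ => //.
  by rewrite thinR_sym.
rewrite -(leq_pmul2r p_gt0) -cI cD.
by have := leq_mul p_gt0 p_gt0; have := p_gt0; lia.
Qed.

(** * Relations outside the thin residue are moved regularly *)

(* [rho a b] maps cosets of the thin radical to cosets of the thin radical. *)
Definition good a b : bool :=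
  [forall x, forall y, forall x', forall y',
     [==> rho x y == rho a b, rho x' y' == rho a b, thinR x x' => thinR y y']].

Lemma goodP a b : reflect
  (forall x y x' y', rho x y = rho a b -> rho x' y' = rho a b ->
     thinR x x' -> thinR y y') (good a b).
Proof.
apply: (iffP idP) => [ab x y x' y' /eqP e /eqP e' xx | ab].
  have /forallP/(_ x)/forallP/(_ y)/forallP/(_ x')/forallP/(_ y') := ab.
  by rewrite e e' xx.
apply/forallP=> x; apply/forallP=> y; apply/forallP=> x'; apply/forallP=> y'.
by apply/implyP=> /eqP ?; apply/implyP=> /eqP ?; apply/implyP; exact: ab.
Qed.

Lemma good_trans a b c : good a b -> good b c -> good a c.
Proof.
move=> /goodP ab /goodP bc; apply/goodP=> x z x' z' e e' xx.
have [y e1 e2] := rho_transfer hS b (esym e).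
have [y' e1' e2'] := rho_transfer hS b (esym e').
by apply: (bc y z y' z') (ab x y x' y' _ _ _) => //; exact: rho_sym.
Qed.

Lemma const_on_sym a b : resR a b -> ~~ thinR a b ->
  forall x, thinR a x -> rho x b = rho a b.
Proof.
move=> ab nab x ax; apply: (rho_sym hS).
by apply: resR_const ax; rewrite 1?resR_sym // thinR_sym.
Qed.

Lemma resR_good a b : resR a b -> good a b.
Proof.
move=> ab; apply/goodP=> x y x' y' e e' xx.
have xy : resR x y by rewrite (resR_eq e).
have [txy|ntxy] := boolP (thinR x y).
  have txy' : thinR x' y' by rewrite (thinR_eq (etrans e' (esym e))).
  apply: (thinR_trans hS) txy'; apply: (thinR_trans hS) xx.
  by rewrite thinR_sym.
have E : rho x' y = rho x y := const_on_sym xy ntxy xx.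
apply: (@const_fiber x'); first by rewrite (thinR_eq E).
  by apply: resR_const; rewrite ?(resR_eq E) // (thinR_eq E).
by rewrite e' E e.
Qed.

(** Otherwise C would be strongly normal, and minimality would put T inside C. *)
Lemma not_all_good : ~ forall a b, good a b.
Proof.
move=> allgood; case/properP: hproper => _ [s sT]; apply/negP/negPn.
have clC := closed_thin_radical hS.
have [_ _ /(_ _ clC) minT] := thin_residueP hS.
apply: (subsetP (minT _)) sT; apply/(thin_factorP hS clC) => u a b a' b' uS.
rewrite -!(rho_eq hS _ _ uS) => /eqP ab /eqP ab'.
rewrite !(mem_cover_closed hS clC (rho_in hS _ _) (mem_rho hS _ _)).
by move: ab; rewrite -ab' => ab; move/goodP: (allgood a b); apply.
Qed.

Lemma fiber_other a b : ~~ thinR a b -> exists2 y, y != b & rho a y = rho a b.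
Proof.
move=> nab; have := card_fiber nab; rewrite (cardsD1 b) inE eqxx => e.
have : 0 < #|[set x | rho a x == rho a b] :\ b| by move: p_gt1; rewrite -e.
by case/card_gt0P=> y; rewrite !inE => /andP[? /eqP ?]; exists y.
Qed.

(* Otherwise the fiber of [rho a b] through [b] would contain, besides [b], a full
   fiber of a relation of valency [p]. *)
Lemma inj_not_const_conv a b : ~~ resR a b -> inj_on a b -> ~ const_on b a.
Proof.
move=> nab inj cst.
have nt : ~~ thinR a b by apply: contra nab; exact: thin_resR.
have nt' : ~~ thinR b a by rewrite thinR_sym.
have [y nyb e] := fiber_other nt.
have nby : ~~ thinR b y.
  by apply: contraNN nyb => by_; apply/eqP/inj; rewrite ?thinR_refl.
have sub : b |: [set z | rho b z == rho b y] \subset [set z | rho a z == rho a b].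
  apply/subsetP=> z; rewrite !inE => /orP[/eqP-> //|/eqP ez].
  have [a' e1 e2] := rho_transfer hS a (esym ez).
  have aa := const_fiber nt' cst e1.
  have [g gG ga] : exists2 g, g \in thin_group & g a' = a.
    by apply/(thin_permE hS); rewrite thinR_sym.
  have /(thin_perm_r hS gG) : rho z a' = rho b a by rewrite e2; exact: rho_sym.
  rewrite ga cst => [/(rho_sym hS) -> //|].
  by have [/(_ a)] := thin_permsP _ _ gG.
have := subset_leq_card sub; rewrite cardsU1 !card_fiber // inE.
case: eqP => [eb|_]; last by rewrite ltnn.
by case/negP: nby; rewrite -(thinR_eq eb) thinR_refl.
Qed.

Lemma not_good_not_resR a b : ~~ good a b -> ~~ resR a b.
Proof. by apply: contra; exact: resR_good. Qed.

(** If [const_on] holds in both directions, the fibers are cosets of C and the relation is good;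
    [inj_not_const_conv] excludes a single direction. *)
Lemma not_good_inj a b : ~~ good a b -> inj_on a b.
Proof.
move=> ng; have nab := not_good_not_resR ng.
case: (const_or_inj a b) => // cst; case/negP: ng.
apply/goodP=> x y x' y' e e' xx.
have nxy : ~~ resR x y by rewrite (resR_eq e).
have cxy : const_on x y by apply: const_on_eq cst.
have cxy' : const_on x' y' by apply: const_on_eq cst.
case: (const_or_inj y x) => [cyx|inj]; last first.
  by case: (inj_not_const_conv _ inj cxy); rewrite resR_sym.
have E : rho x' y = rho x' y'.
  by rewrite e' -e; apply: (rho_sym hS); exact: cyx.
rewrite thinR_sym //; apply: (@const_fiber x') => //.
by rewrite (thinR_eq (etrans e' (esym e))); apply: contra nxy; exact: thin_resR.
Qed.

Lemma not_good_inj_conv a b : ~~ good a b -> inj_on b a.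
Proof.
move=> ng; case: (const_or_inj b a) => // cst.
by case: (inj_not_const_conv (not_good_not_resR ng) (not_good_inj ng) cst).
Qed.

(** Seen from [a], the coset of T through [b] splits into [p] fibers, and the coset of C already
    meets [p] of them. *)
Lemma inj_image a b : ~~ resR a b -> inj_on a b ->
  rho a @: [set x | thinR b x] = rho a @: [set x | resR b x].
Proof.
move=> nab inj; apply/eqP; rewrite eqEcard imsetS /=; last first.
  by apply/subsetP=> x; rewrite !inE; exact: thin_resR.
have -> : #|rho a @: [set x | thinR b x]| = p.
  by rewrite -(card_thinR b) card_in_imset // => x y; rewrite !inE; exact: inj.
rewrite -(leq_pmul2r p_gt0) -card_image_fibers ?card_resR //.
  move=> y x; rewrite !inE => by_ e; apply: resR_trans by_ _.
  exact: resR_normal (esym e) (resR_refl a).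
move=> y; rewrite inE => by_; apply: contra nab => /thin_resR ay.
by apply: resR_trans ay _; rewrite resR_sym.
Qed.

(** The same [p] relations join the two cosets of T, whatever point they are read from. *)
Lemma inj_surj a b a' y : ~~ resR a b -> inj_on a b -> resR a a' -> resR b y ->
  exists2 x, thinR b x & rho a x = rho a' y.
Proof.
move=> nab inj aa by_; have [y' e] := rho_exists hS a' y a.
have : rho a y' \in rho a @: [set x | resR b x].
  apply: imset_f; rewrite inE; apply: resR_trans by_ _.
  by apply: (resR_normal (esym e)); rewrite resR_sym.
by rewrite -inj_image // => /imsetP[x]; rewrite inE -e => bx ->; exists x.
Qed.

Lemma sum_bool_inj a b a' y : ~~ resR a b -> inj_on a b -> resR a a' -> resR b y ->
  \sum_(x | thinR b x) nat_of_bool (rho a x == rho a' y) = 1.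
Proof.
move=> nab inj aa by_; apply/eqP; rewrite eqn_leq; apply/andP; split.
  apply: sum_nat_eq_leq1 => x z bx bz /eqP ex /eqP ez.
  by apply: inj; rewrite ?ex ?ez.
have [x bx e] := inj_surj nab inj aa by_.
by rewrite (bigD1 x) //= e eqxx.
Qed.

(** By constancy the count is the same with [b'] replaced by any of the [p] points [x] of its coset
    of C. These counts add up to [p], because each of the [p] points [a] with [rho b a = rho b a1]
    meets the second condition for exactly one [x]. *)
Lemma card_meet1 b b' a1 a2 : const_on b b' -> ~~ resR b a1 -> ~~ resR b' a1 ->
  resR a1 a2 -> (forall a, resR a1 a -> inj_on a b') ->
  #|[set a | (rho b a == rho b a1) && (rho b' a == rho b' a2)]| = 1.
Proof.
move=> cst nba nba' a12 inj.
have E x : thinR b' x -> \sum_(a | rho b a == rho b a1) nat_of_bool (rho x a == rho b' a2)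
    = #|[set a | (rho b a == rho b a1) && (rho b' a == rho b' a2)]|.
  move=> bx; rewrite (card_meet hS) ?rho_in // -(cst x bx) -(card_meet hS) ?rho_in //.
  by rewrite -big_mkcondr sum1dep_card.
have nt : ~~ thinR b a1 by apply: contra nba; exact: thin_resR.
apply/eqP; rewrite -(eqn_pmul2l p_gt0) -{1}(card_thinR b') muln1.
rewrite -sum_nat_cond_const /= -(eq_bigr _ E) exchange_big /=.
rewrite -(card_fiber nt) -sum1_card; apply/eqP.
transitivity (\sum_(a | rho b a == rho b a1) 1); last by apply: eq_bigl => a; rewrite inE.
apply: eq_bigr => a /eqP ea.
have aa1 : resR a1 a := resR_normal (esym ea) (resR_refl b).
have nab : ~~ resR a b'.
  by apply: contra nba' => ab; rewrite resR_sym; apply: resR_trans ab.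
have aa2 : resR a a2 by apply: resR_trans a12; rewrite resR_sym.
rewrite -[RHS](sum_bool_inj nab (inj a aa1) aa2 (resR_refl b')).
by apply: eq_bigr => x _; congr nat_of_bool; apply/eqP/eqP; exact: rho_sym.
Qed.

(** A good [rho a a'] and a bad [rho a b] yield two lines, one seen from [a] and one from the coset
    of [a'], that must meet once but share [b] and [b']. *)
Lemma not_resR_not_good a a' : ~~ resR a a' -> ~~ good a a'.
Proof.
move=> naa; apply/negP=> gaa; apply: not_all_good => x y.
have [b eb] := rho_exists hS x y a.
suff /goodP gab : good a b by apply/goodP; rewrite -eb.
apply/negPn/negP => ngab.
have ngab' : ~~ good a' b by apply: contra ngab; exact: good_trans.
have [nab nab'] := (not_good_not_resR ngab, not_good_not_resR ngab').
have nt : ~~ thinR a b by apply: contra nab; exact: thin_resR.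
have [b' nbb e] := fiber_other nt.
have ntbb : ~~ thinR b b'.
  by apply: contraNN nbb => tbb; apply/eqP/(not_good_inj ngab); rewrite ?thinR_refl.
have bb : resR b b' := resR_normal (esym e) (resR_refl a).
have [a2 ea2] := rho_exists hS b a' b'.
have aa2 : resR a' a2 := resR_normal (esym ea2) bb.
(* Such a [c] sees [b] and [b'] in the same relation, since [rho b' a2 = rho b a']. *)
have : 0 < #|[set c | (rho b c == rho b a') && (rho b' c == rho b' a2)]|.
  rewrite card_meet1 //.
  - exact: resR_const.
  - by rewrite resR_sym.
  - by apply: contra nab' => ba; apply: resR_trans (_ : resR b' b); rewrite resR_sym.
  - move=> c ac; apply: not_good_inj; apply: contra ngab' => cb.
    apply: good_trans (resR_good ac) (good_trans cb (resR_good _)).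
    by rewrite resR_sym.
case/card_gt0P=> c; rewrite inE => /andP[/eqP ec /eqP ec'].
have ca : resR a' c := resR_normal (esym ec) (resR_refl b).
have gac : good a c := good_trans gaa (resR_good ca).
have nac : ~~ resR a c by apply: contra naa => ac; apply: resR_trans ac _; rewrite resR_sym.
have ntac : ~~ thinR a c by apply: contra nac; exact: thin_resR.
have ngcb : ~~ good c b by apply: contra ngab; exact: good_trans.
(* Injectivity fails because goodness keeps the whole fiber through [c] in one coset of C. *)
have cac : const_on a c.
  case: (const_or_inj a c) => // inj; have [z nzc ez] := fiber_other ntac.
  case/eqP: nzc; apply: inj; rewrite ?thinR_refl //.
  by move/goodP: gac => /(_ a c a z); apply; rewrite ?thinR_refl.
(* Both [b] and [b'] are counted here, against [card_meet1]. *)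
have : 1 < #|[set x | (rho a x == rho a b) && (rho c x == rho c b)]|.
  rewrite (cardsD1 b) inE !eqxx (cardsD1 b') !inE nbb e eqxx /=.
  suff -> : rho c b' == rho c b by [].
  by apply/eqP/(rho_sym hS); rewrite ec' ea2 ec.
rewrite card_meet1 ?resR_refl //; first exact: not_good_not_resR.
move=> d bd; apply: not_good_inj_conv; apply: contra ngcb => cd.
by apply: good_trans cd (resR_good _); rewrite resR_sym.
Qed.

Lemma not_resR_inj a b : ~~ resR a b -> inj_on a b.
Proof. by move=> nab; exact/not_good_inj/not_resR_not_good. Qed.

(** * Affine planes on a coset of the thin residue *)

(* The cosets of the thin radical in [b T] and the fibers of the relations from a
   coset [a1 T <> b T] are the lines of an affine plane of order [p] on [b T]. *)
Lemma affine b b' a1 a2 : resR b b' -> ~~ thinR b b' -> ~~ resR b a1 ->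
  resR a1 a2 -> #|[set a | (rho b a == rho b a1) && (rho b' a == rho b' a2)]| = 1.
Proof.
move=> bb tbb nba a12.
have nba' : ~~ resR b' a1 by apply: contra nba; exact: resR_trans.
apply: card_meet1 => // [|a aa]; first exact: resR_const.
apply: not_resR_inj; apply: contra nba' => ab; rewrite resR_sym.
exact: resR_trans ab.
Qed.

(** As [x] runs over the coset of C, [rho a x] runs once through the [p] relations joining the two
    cosets of T. *)
Lemma sum_equidistributed (h : {set Omega * Omega} -> nat) a a' c c' :
  ~~ resR a a' -> resR a c -> resR a' c' ->
  \sum_(x | thinR a' x) h (rho a x) = \sum_(x | thinR c' x) h (rho c x).
Proof.
have sum_image u v : ~~ resR u v -> \sum_(x | thinR v x) h (rho u x)
    = \sum_(s in rho u @: [set x | thinR v x]) h s.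
  move=> nuv; rewrite big_imset => [|x y]; last first.
    by rewrite !inE; exact: not_resR_inj.
  by apply: eq_bigl => x; rewrite inE.
have sub u v w z : ~~ resR u v -> resR u w -> resR v z ->
    rho w @: [set x | thinR z x] \subset rho u @: [set x | thinR v x].
  move=> nuv uw vz; apply/subsetP=> s /imsetP[x]; rewrite inE => zx ->.
  have [y vy <-] := inj_surj nuv (not_resR_inj nuv) uw (resR_trans vz (thin_resR zx)).
  by apply: imset_f; rewrite inE.
move=> naa ac ac'.
have ncc : ~~ resR c c'.
  apply: contra naa => cc; apply: resR_trans ac (resR_trans cc _).
  by rewrite resR_sym.
rewrite !sum_image //; apply: eq_bigl; apply/setP/eqP; rewrite eqEsubset.
by apply/andP; split; apply: sub; rewrite // resR_sym.
Qed.

(** * The second-moment count *)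

Section Moments.

Variables b0 b1 : Omega.
Hypothesis res01 : resR b0 b1.
Hypothesis nthin01 : ~~ thinR b0 b1.

Local Notation out a := (~~ resR b0 a).
Local Notation n := #|[set a | ~~ resR b0 a]|.

Let idx (e : Omega * Omega) := out e.1 && thinR e.1 e.2.
Let hit0 (e : Omega * Omega) b : nat := rho e.2 b == rho e.1 b0.
Let hit1 (e : Omega * Omega) b : nat := rho e.2 b == rho e.1 b1.

(** For fixed [a] the pairs hit form [p] disjoint products of two parallel lines, one for each [x]
    in the coset of [a] under C. *)
Definition hits b c : nat := \sum_(e | idx e) hit0 e b * hit1 e c.

Lemma out_trans a x : out a -> resR a x -> out x.
Proof.
by move=> oa ax; apply: contra oa => bx; apply: resR_trans bx _; rewrite resR_sym.
Qed.

Lemma out_sym a : out a -> ~~ resR a b0.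
Proof. by rewrite resR_sym. Qed.

Lemma sum_idx (f : Omega * Omega -> nat) :
  \sum_(e | idx e) f e = \sum_(a | out a) \sum_(x | thinR a x) f (a, x).
Proof. by rewrite pair_big_dep /=; apply: eq_big => [[]|[]]. Qed.

Lemma sum_thin_const a m : \sum_(x | thinR a x) m = p * m.
Proof. by rewrite sum_nat_cond_const card_thinR. Qed.

Lemma sum_out_const m : \sum_(a | out a) m = n * m.
Proof. by rewrite sum_nat_cond_const. Qed.

Lemma sum_res_fiber a x y : out a -> resR a x -> resR b0 y ->
  \sum_(b | resR b0 b) nat_of_bool (rho x b == rho a y) = p.
Proof.
move=> oa ax by_; have [z ez] := rho_exists hS a y x.
have nt : ~~ thinR x z.
  rewrite (thinR_eq ez); apply: contra oa => /thin_resR ay.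
  by apply: resR_trans by_ _; rewrite resR_sym.
rewrite -(card_fiber nt) -big_mkcondr sum1dep_card ez.
apply: eq_card => b; rewrite !inE andb_idl // => /eqP e.
apply: resR_trans by_ _; exact: resR_normal (esym e) ax.
Qed.

Lemma sum_hits :
  \sum_(b | resR b0 b) \sum_(c | resR b0 c) hits b c = n * p ^ 3.
Proof.
rewrite exchange_sum_prod sum_idx -sum_out_const; apply: eq_bigr => a oa.
rewrite [RHS](_ : _ = p * (p * p)) // -(sum_thin_const a); apply: eq_bigr => x ax.
have {}ax := thin_resR ax.
by rewrite /hit0 /hit1 /= !(sum_res_fiber oa ax) ?resR_refl.
Qed.

(** A line meets each coset of C once, so every pair in [idx] contributes 1. *)
Lemma sum_hits_thin :
  \sum_(b | thinR b0 b) \sum_(c | thinR b1 c) hits b c = n * p.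
Proof.
rewrite exchange_sum_prod sum_idx -sum_out_const; apply: eq_bigr => a oa.
rewrite [RHS](esym (muln1 p)) -(sum_thin_const a); apply: eq_bigr => x /thin_resR ax.
have nx0 := out_sym (out_trans oa ax).
have nx1 : ~~ resR x b1.
  by apply: contra nx0 => x1; apply: resR_trans x1 _; rewrite resR_sym.
have xa : resR x a by rewrite resR_sym.
rewrite /hit0 /hit1 /= (sum_bool_inj nx0 (not_resR_inj nx0) xa (resR_refl _)).
by rewrite (sum_bool_inj nx1 (not_resR_inj nx1) xa (resR_refl _)).
Qed.

(* The pair [(b, c)] is the translate of [(b0, b1)] by a thin element [g];
   it is hit once for every [a] because the thin elements commute. *)
Lemma hits_translate b : thinR b0 b -> exists2 c, thinR b1 c & n <= hits b c.
Proof.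
case/(thin_permE hS) => g gG gb; have [tg _] := thin_permsP _ _ gG.
exists (g b1) => //; rewrite -[n]muln1 -sum_out_const /hits sum_idx.
apply: leq_sum => a oa.
have b0b : resR b b0 by rewrite resR_sym -gb; exact/thin_resR/tg.
have nba : ~~ resR b a by apply: contra oa; apply: resR_trans; rewrite resR_sym.
have [x ax ex] := inj_surj nba (not_resR_inj nba) b0b (resR_refl a).
have nab := out_sym oa.
(* [b1] is not a thin translate of [b0]; its stand-in [h b0], in the same fiber from [a], is one, so
   that commuting [g] and [h] applies. *)
have [b2 + e2] := inj_surj nab (not_resR_inj nab) (resR_refl a) res01.
case/(thin_permE hS) => h hG hb; case/(thin_permE hS): (ax) => k kG ka.
have e0 : rho x b = rho a b0 by exact: rho_sym.
have e3 : rho x (h b) = rho a b1 by rewrite (thin_perm_r hS hG e0) hb.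
have e4 : rho a (h b) = rho a (g b1).
  rewrite -gb (thin_group_comm hG gG) hb; exact: thin_perm_r.
have e5 : rho x (g b1) = rho a b1.
  by rewrite -e3 -ka; apply: (thin_perm_l hS kG (esym e4)).
by rewrite (bigD1 x) //= /hit0 /hit1 /= e0 e5 !eqxx.
Qed.

(** For [u = rho x x'], the number of [(b, c)] hit through both [(a, x)] and [(a', x')]. *)
Let meets a a' u :=
  intnum (rho a b0) (conv (rho a' b0)) u * intnum (rho a b1) (conv (rho a' b1)) u.

(** The inner product of the contributions of [a] and [a'] to [hits]. *)
Let weight a a' := \sum_(x | thinR a x) \sum_(x' | thinR a' x') meets a a' (rho x x').

Lemma sum_res_meet a x x' y s : resR a x -> resR b0 y -> s \in S ->
  \sum_(b | resR b0 b) nat_of_bool (rho x b == rho a y) * nat_of_bool (rho x' b == s)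
  = intnum (rho a y) (conv s) (rho x x').
Proof.
move=> ax by_ sS; rewrite -(card_meet hS) ?rho_in //.
under eq_bigr do rewrite mulnb.
rewrite -big_mkcondr sum1dep_card; apply: eq_card => b; rewrite !inE.
rewrite andb_idl // => /andP[/eqP e _].
apply: resR_trans by_ _; exact: resR_normal (esym e) ax.
Qed.

Lemma sum_hits_sqr : \sum_(b | resR b0 b) \sum_(c | resR b0 c) hits b c ^ 2
  = \sum_(a | out a) \sum_(a' | out a') weight a a'.
Proof.
transitivity (\sum_(b | resR b0 b) \sum_(c | resR b0 c)
   \sum_(e | idx e.1 && idx e.2) (hit0 e.1 b * hit0 e.2 b) * (hit1 e.1 c * hit1 e.2 c)).
  apply: eq_bigr => b _; apply: eq_bigr => c _.
  rewrite -mulnn /hits big_distrlr pair_big /=; apply: eq_bigr => e _.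
  by rewrite mulnACA.
rewrite exchange_sum_prod.
rewrite -(pair_big idx idx (fun i j => (\sum_(b | resR b0 b) hit0 i b * hit0 j b)
    * (\sum_(c | resR b0 c) hit1 i c * hit1 j c))) /=.
rewrite sum_idx; apply: eq_bigr => a oa.
under eq_bigr => x _ do rewrite sum_idx.
rewrite exchange_big /=; apply: eq_bigr => a' oa'.
apply: eq_bigr => x /thin_resR ax; apply: eq_bigr => x' _.
by rewrite /hit0 /hit1 /= !sum_res_meet ?rho_in ?resR_refl.
Qed.

(** For each of the [p] points [x], the factor of [meets] at [b1] is at most [p], and the factors at
    [b0] add up over [x'] to at most [p]: a point lies on the line of at most one [x']. *)
Lemma weight_le a a' : out a -> out a' -> weight a a' <= p ^ 3.
Proof.
move=> oa oa'; rewrite [p ^ 3](_ : _ = p * (p * p)) // -(sum_thin_const a).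
apply: leq_sum => x /thin_resR ax.
have le2 x' : intnum (rho a b1) (conv (rho a' b1)) (rho x x') <= p.
  rewrite -(sum_res_fiber oa ax res01) -(sum_res_meet _ ax res01) ?rho_in //.
  by apply: leq_sum => b _; rewrite -[leqRHS]muln1 leq_mul2l leq_b1 orbT.
apply: (@leq_trans (\sum_(x' | thinR a' x')
          intnum (rho a b0) (conv (rho a' b0)) (rho x x') * p)).
  by apply: leq_sum => x' _; rewrite leq_mul2l le2 orbT.
rewrite -big_distrl leq_mul2r; apply/orP; right.
under eq_bigr => x' _ do rewrite -(sum_res_meet x' ax (resR_refl b0) (rho_in hS a' b0)).
rewrite exchange_big /= -(sum_res_fiber oa ax (resR_refl b0)).
apply: leq_sum => b bb; rewrite -big_distrr /= -[leqRHS]muln1 leq_mul2l.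
apply/orP; right; apply: sum_nat_eq_leq1 => y z a'y a'z /eqP ey /eqP ez.
have nba : ~~ resR b a'.
  by apply: contra oa'; exact: resR_trans.
by apply: (not_resR_inj nba) => //; apply: (rho_sym hS); rewrite ey ez.
Qed.

(** Lines seen from [a] and from [a'] are not parallel, so by [affine] each of the [p ^ 2] values of
    [meets] is 1. *)
Lemma weight_res a a' : out a -> resR a a' -> ~~ thinR a a' -> weight a a' <= p ^ 2.
Proof.
move=> oa aa naa; rewrite -[p ^ 2]mulnn -{1}[p]muln1 -(sum_thin_const a) big_distrl.
apply: leq_sum => x ax /=; rewrite mul1n -[p]muln1 -(sum_thin_const a').
apply: leq_sum => x' ax'.
have [tax tax'] := (thin_resR ax, thin_resR ax').
have xx : resR x x' by apply: resR_trans (resR_trans aa tax'); rewrite resR_sym.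
have nxx : ~~ thinR x x'.
  apply: contra naa => xx'; apply: (thinR_trans hS) ax (thinR_trans hS xx' _).
  by rewrite thinR_sym.
have one y : resR b0 y -> intnum (rho a y) (conv (rho a' y)) (rho x x') = 1.
  move=> by_; rewrite -(card_meet hS) ?rho_in //.
  have [y1 e1] := rho_exists hS a y x; have [y2 e2] := rho_exists hS a' y x'.
  have yy1 := resR_normal (esym e1) tax; have yy2 := resR_normal (esym e2) tax'.
  rewrite -e1 -e2; apply: affine => //.
    apply: contra (out_trans oa tax) => xy.
    by apply: resR_trans by_ (resR_trans yy1 _); rewrite resR_sym.
  by apply: resR_trans yy2; rewrite resR_sym.
by rewrite /meets !one ?resR_refl.
Qed.

Lemma affine_le a b c : out a -> resR b0 b -> resR b0 c ->
  \sum_(x | resR a x) nat_of_bool (rho a b == rho x b0) * nat_of_bool (rho a c == rho x b1)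
  <= 1.
Proof.
move=> oa rb rc.
have [a1 e1] := rho_exists hS b a b0; have [a2 e2] := rho_exists hS c a b1.
have aa1 : resR a a1 by apply: (resR_normal (esym e1)); rewrite resR_sym.
have aa2 : resR a a2.
  by apply: (resR_normal (esym e2)); apply: resR_trans res01; rewrite resR_sym.
rewrite -(@affine b0 b1 a1 a2) //.
- under eq_bigr do rewrite mulnb.
  rewrite -big_mkcondr sum1dep_card; apply/subset_leq_card/subsetP=> x.
  rewrite !inE => /and3P[_ /eqP /(rho_sym hS) + /eqP /(rho_sym hS)].
  by rewrite e1 e2 => -> ->; rewrite !eqxx.
- exact: out_trans aa1.
- by apply: resR_trans aa2; rewrite resR_sym.
Qed.

Let apart (e : Omega * Omega) := [&& out e.1, out e.2 & ~~ resR e.1 e.2].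
Let near (e f : Omega * Omega) := resR e.1 f.1 && resR e.2 f.2.

(** After exchanging sums, for fixed [b] and [c] the conditions on [e.1] and [e.2] separate, and
    [affine_le] leaves at most one choice for each. *)
Lemma sum_near_meets a a' : apart (a, a') ->
  \sum_(e | near (a, a') e) \sum_(x | thinR a' x) meets e.1 e.2 (rho a x) <= p * p ^ 4.
Proof.
case/and3P=> /= oa oa' naa.
rewrite exchange_big /= -(sum_thin_const a'); apply: leq_sum => x /thin_resR ax.
have ox := out_trans oa' ax.
have -> : \sum_(e | near (a, a') e) meets e.1 e.2 (rho a x)
  = \sum_(e | near (a, a') e)
     (\sum_(b | resR b0 b) nat_of_bool (rho a b == rho e.1 b0)
        * nat_of_bool (rho x b == rho e.2 b0))
   * (\sum_(c | resR b0 c) nat_of_bool (rho a c == rho e.1 b1)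
        * nat_of_bool (rho x c == rho e.2 b1)).
  apply: eq_bigr => e /andP[/= ae1 ae2].
  by rewrite !sum_res_meet ?rho_in ?resR_refl // resR_sym.
rewrite -exchange_sum_prod [p ^ 4](_ : _ = p ^ 2 * (p ^ 2 * 1)); last by rewrite muln1 -expnD.
have sum_res m : \sum_(b | resR b0 b) m = p ^ 2 * m.
  by rewrite sum_nat_cond_const card_resR.
rewrite -sum_res; apply: leq_sum => b rb; rewrite -sum_res; apply: leq_sum => c rc.
have := leq_mul (affine_le oa rb rc) (affine_le ox rb rc).
rewrite big_distrlr pair_big /= => le1; apply: leq_trans le1.
apply: eq_leq; apply: eq_big => [e|e _]; last by rewrite mulnACA.
congr (_ && _); apply/idP/idP; apply: resR_trans => //.
by rewrite resR_sym.
Qed.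

(** By [sum_equidistributed], all [p] inner sums agree with the one read from [f]. *)
Lemma weight_near e f : apart e -> near e f ->
  weight e.1 e.2 = p * \sum_(x | thinR f.2 x) meets e.1 e.2 (rho f.1 x).
Proof.
case/and3P=> oe1 oe2 ne /andP[ef1 ef2].
rewrite -(sum_thin_const e.1); apply: eq_bigr => x /thin_resR ex.
apply: sum_equidistributed => //.
  by apply: contra ne; exact: resR_trans.
by apply: resR_trans ef1; rewrite resR_sym.
Qed.

(* Off the diagonal, [weight] averages to [p ^ 2] over each product of two
   cosets of the thin residue: it may be computed at any base pair [f] of the
   product, and summing over the base pairs makes the conditions decouple. *)
Lemma sum_weight_apart : \sum_(e | apart e) weight e.1 e.2 <= #|[set e | apart e]| * p ^ 2.
Proof.
have near_apart e f : apart e -> near e f -> apart f.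
  case/and3P=> oe1 oe2 ne /andP[ef1 ef2]; apply/and3P; split.
  - exact: out_trans ef1.
  - exact: out_trans ef2.
  - apply: contra ne => ff; apply: resR_trans ef1 (resR_trans ff _).
    by rewrite resR_sym.
have near_sym e f : near e f = near f e by rewrite /near !(resR_sym f.1, resR_sym f.2).
have card_near e : #|[set f | near e f]| = p ^ 4.
  rewrite -[4]/(2 + 2) expnD -{1}(card_resR e.1) -(card_resR e.2) -cardsX.
  by apply: eq_card => -[f1 f2]; rewrite !inE.
have p4_gt0 : 0 < p ^ 4 by rewrite expn_gt0 p_gt0.
rewrite -(leq_pmul2l p4_gt0) big_distrr /=.
have -> : \sum_(e | apart e) p ^ 4 * weight e.1 e.2 = \sum_(e | apart e) \sum_(f | near e f)
    p * \sum_(x | thinR f.2 x) meets e.1 e.2 (rho f.1 x).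
  apply: eq_bigr => e ae; rewrite -(card_near e) -sum_nat_cond_const.
  by apply: eq_bigr => f; exact: weight_near.
rewrite (exchange_big_dep apart) //=.
rewrite (_ : p ^ 4 * _ = #|[set e | apart e]| * (p * (p * p ^ 4))); last first.
  by rewrite mulnCA; congr (_ * _); rewrite -expnD -!expnS.
rewrite -sum_nat_cond_const; apply: leq_sum => -[a a'] af.
rewrite -big_distrr /= leq_mul2l; apply/orP; right.
apply: leq_trans (sum_near_meets af); apply: eq_leq; apply: eq_bigl => e.
by rewrite near_sym andb_idl // => /(near_apart _ _ af).
Qed.

Lemma card_apart : #|[set e | apart e]| + n * p ^ 2 = n * n.
Proof.
rewrite -!sum_out_const -sum1dep_card.
rewrite (eq_bigl (fun e => out e.1 && (out e.2 && ~~ resR e.1 e.2))) //.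
rewrite -(pair_big_dep (fun a => out a) (fun a c => out c && ~~ resR a c) (fun _ _ => 1)).
rewrite -big_split; apply: eq_bigr => a oa /=.
rewrite -(card_resR a) -(cardsID [set c | resR a c] [set c | out c]) addnC.
congr (_ + _).
  apply: eq_card => c; rewrite !inE andb_idl //; exact: out_trans.
by rewrite sum1dep_card; apply: eq_card => c; rewrite !inE andbC.
Qed.

(** For each [a], the [p] points of its coset of C contribute at most [p ^ 3] each and the other
    points of its coset of T at most [p ^ 2] each; pairs in different cosets of T are averaged. *)
Lemma sum_hits_sqr_le :
  \sum_(b | resR b0 b) \sum_(c | resR b0 c) hits b c ^ 2
  <= n * (p * p ^ 3 + (p ^ 2 - p) * p ^ 2) + #|[set e | apart e]| * p ^ 2.
Proof.
rewrite sum_hits_sqr.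
apply: leq_trans (leq_add (leqnn _) sum_weight_apart).
rewrite (eq_bigl (fun e => out e.1 && (out e.2 && ~~ resR e.1 e.2))) //.
rewrite -(pair_big_dep (fun a => out a) (fun a c => out c && ~~ resR a c)).
rewrite -sum_out_const -big_split; apply: leq_sum => a oa /=.
rewrite (bigID (resR a)) /= leq_add2r (bigID (thinR a)) /=; apply: leq_add.
  rewrite -(sum_thin_const a) (eq_bigl (thinR a)) => [|c].
    by apply: leq_sum => c ac; apply: weight_le => //; apply: out_trans (thin_resR ac).
  rewrite andb_idl // => /thin_resR ac; rewrite ac andbT; exact: out_trans ac.
have subTC : [set x | thinR a x] \subset [set x | resR a x].
  by apply/subsetP=> x; rewrite !inE; exact: thin_resR.
have <- : #|[set x | resR a x] :\: [set x | thinR a x]| = p ^ 2 - p.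
  by rewrite cardsDS // card_resR card_thinR.
rewrite -sum_nat_const.
rewrite [leqRHS](eq_bigl (fun c => (out c && resR a c) && ~~ thinR a c)) => [|c].
  by apply: leq_sum => c /andP[/andP[_ ac] nac]; exact: weight_res.
rewrite !inE andbC; congr (_ && _); rewrite [RHS]andb_idl //; exact: out_trans.
Qed.

(** The upper bound [sum_hits_sqr_le] is played against a lower bound: the [p] translates of
    [(b0, b1)] inside [dbox], and the mean of [hits] elsewhere. *)
Lemma card_out_le : n <= p ^ 3.
Proof.
pose box e := resR b0 e.1 && resR b0 e.2.
pose dbox e := thinR b0 e.1 && thinR b1 e.2.
have dbox_box e : dbox e -> box e.
  case/andP=> e1 e2; rewrite /box thin_resR //=.
  exact: resR_trans res01 (thin_resR e2).
have split_box f : \sum_(b | resR b0 b) \sum_(c | resR b0 c) f b c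
    = \sum_(b | thinR b0 b) \sum_(c | thinR b1 c) f b c
      + \sum_(e | box e && ~~ dbox e) f e.1 e.2 :> nat.
  rewrite pair_big /= (bigID dbox) /=; congr (_ + _).
  by rewrite pair_big; apply: eq_bigl => e; rewrite andb_idl // => /dbox_box.
have Qle := sum_hits_sqr_le; rewrite (split_box (fun b c => hits b c ^ 2)) in Qle.
have total := sum_hits; rewrite split_box sum_hits_thin in total.
have size := split_box (fun _ _ => 1).
rewrite !sum_nat_cond_const !card_resR !card_thinR in size.
have diag_le : p * n ^ 2 <= \sum_(b | thinR b0 b) \sum_(c | thinR b1 c) hits b c ^ 2.
  rewrite -(sum_thin_const b0); apply: leq_sum => b /hits_translate[c tc le].
  by rewrite (bigD1 c) //=; apply: leq_trans (leq_addr _ _); rewrite leq_exp2r.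
(* Off [dbox], [hits] averages to [n / p], the value at which this inequality is sharp. *)
have amgm : \sum_(e | box e && ~~ dbox e) 2 * (p * n) * hits e.1 e.2
    <= \sum_(e | box e && ~~ dbox e) (p ^ 2 * hits e.1 e.2 ^ 2 + n ^ 2 * 1).
  apply: leq_sum => e _; rewrite muln1 -expnMn -mulnA [p * n * _]mulnAC.
  exact: nat_Cauchy.
rewrite big_split /= -!big_distrr /= in amgm.
rewrite sum1dep_card in amgm.
have [->//|n_gt0] := posnP n.
apply: (moment_bound p_gt1 n_gt0 Qle total _ diag_le amgm card_apart).
by rewrite -[4]/(2 + 2) expnD !muln1 mulnn in size *.
Qed.

End Moments.

(** * Assembling the bound *)

Lemma card_scheme_le : #|Omega| <= p ^ 2 * (p + 1).
Proof.
(* Properness supplies a relation in T but not in C, hence the base pair of the moment count. *)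
have [_ [s sT sC]] := properP hproper.
have sS : s \in S by case/and3P: clT => _ /subsetP->.
have [[b0 b1]] := rel_nonempty hS sS; rewrite -(rho_eq hS _ _ sS) => /eqP es.
rewrite -es in sT sC; have := card_out_le sT sC.
have -> : #|Omega| = #|[set a | resR b0 a]| + #|[set a | ~~ resR b0 a]|.
  rewrite -cardsT -(cardsID [set a | resR b0 a]) setTI setTD; congr (_ + _).
  by apply: eq_card => a; rewrite !inE.
by rewrite card_resR mulnDr muln1 -expnSr addnC leq_add2r.
Qed.

End ThinResidueOfOrderP2.

Theorem theorem1p1 (p : nat) (Omega : finType) (S : {set {set Omega * Omega}})
    (hp : prime p)
    (hS : association_scheme S)
    (hproper : thin_radical S \proper thin_residue S)
    (hval : forall s : {set Omega * Omega}, s \in S ->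
              valency s = 1 \/ valency s = p)
    (hres : valency_set (thin_residue S) = p ^ 2) :
  #|Omega| <= p ^ 2 * (p + 1).
Proof. exact: (card_scheme_le hp hS hproper hval hres). Qed.
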